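(* Let $X$ be a finite set and let $\mathcal{D}\subseteq\mathcal{R}(X)$ be a maximal single-crossing domain, with its maximal chain $R_1,\dots,R_m$ and switching pairs $\{x_j,y_j\}$ ($j=1,\dots,m-1$). Then $\mathcal{D}$ is a maximal Condorcet domain if and only if the maximal chain satisfies the pairwise concatenation condition: $\{x_j,y_j\}\cap\{x_{j+1},y_{j+1}\}\neq\emptyset$ for all $j=1,\dots,m-2$.
   Context: $\mathcal{R}(X)$ is the set of strict linear orders on $X$. A domain $\mathcal{D}\subseteq\mathcal{R}(X)$ has the single-crossing property (is a single-crossing domain) if its elements can be enumerated $R_1,\dots,R_m$ so that for every pair of distinct $x,y$ the sets $\{j:xR_jy\}$ and $\{j:yR_jx\}$ are intervals of consecutive indices; it is a maximal single-crossing domain if no single-crossing domain on $X$ properly contains it. For a maximal single-crossing domain such an enumeration is unique up to reversal and is called its maximal chain; consecutive orders $R_j,R_{j+1}$ differ exactly in the ranking of one pair of alternatives $\{x_j,y_j\}$ (adjacent in both), called the $j$-th switching pair. A Condorcet domain is a domain on which the majority relation of every profile (tuple of orders from the domain; $x$ above $y$ iff more than half of the voters rank $x$ above $y$) is acyclic; it is maximal if no Condorcet domain on $X$ properly contains it. *)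

(* Defs.v *)
From HB Require Import structures.
From mathcomp Require Import all_boot.

Set Implicit Arguments.
Unset Strict Implicit.
Unset Printing Implicit Defensive.

Definition strict_linear_order (X : finType) (R : {set X * X}) : bool :=
  [&& [forall x, (x, x) \notin R],
      [forall x, forall y, forall z,
         ((x, y) \in R) ==> ((y, z) \in R) ==> ((x, z) \in R)]
    & [forall x, forall y, (x != y) ==> ((x, y) \in R) || ((y, x) \in R)]].

(* The type of all strict linear orders on X; a domain is an element of
   {set linord X}. *)
Record linord (X : finType) := Linord {
  graph : {set X * X};
  _ : strict_linear_order graph
}.

HB.instance Definition _ (X : finType) := [isSub for @graph X].
HB.instance Definition _ (X : finType) := [Finite of linord X by <:].

(* x is ranked above y *)
Definition prefers (X : finType) (R : linord X) (x y : X) : bool :=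
  (x, y) \in graph R.

Definition maximal_domain (X : finType) (P : {set linord X} -> Prop)
    (D : {set linord X}) : Prop :=
  P D /\ ~ (exists D' : {set linord X}, P D' /\ D \proper D').

Definition interval_of_indices (m : nat) (J : {set 'I_m}) : Prop :=
  forall i j k : 'I_m, i <= j -> j <= k -> i \in J -> k \in J -> j \in J.

(* R 0, ..., R (m - 1) enumerates D without repetition and witnesses the
   single-crossing property. When D is a maximal single-crossing domain, this
   says that R is its maximal chain, read in one of the two directions. *)
Definition single_crossing_enum (X : finType) (D : {set linord X})
    (m : nat) (R : 'I_m -> linord X) : Prop :=
  [/\ injective R,
      D = [set R j | j in 'I_m]
    & forall x y : X, x != y ->
        interval_of_indices [set j | prefers (R j) x y] /\
        interval_of_indices [set j | prefers (R j) y x]].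

Definition single_crossing (X : finType) (D : {set linord X}) : Prop :=
  exists (m : nat) (R : 'I_m -> linord X), single_crossing_enum D R.

(* R and R' rank exactly one pair of alternatives differently, namely A. Such an
   A is unique, and by transitivity its two elements are adjacent in R and R'. *)
Definition switching_pair (X : finType) (R R' : linord X) (A : {set X}) : Prop :=
  #|A| = 2 /\
  forall a b : X, a != b ->
    (prefers R a b <> prefers R' a b <-> [set a; b] = A).

(* i, j, k range over triples of consecutive indices. *)
Definition pairwise_concatenation (X : finType) (m : nat)
    (R : 'I_m -> linord X) : Prop :=
  forall i j k : 'I_m, j = i.+1 :> nat -> k = j.+1 :> nat ->
    exists A B : {set X},
      [/\ switching_pair (R i) (R j) A,
          switching_pair (R j) (R k) B
        & A :&: B != set0].

Definition majority (X : finType) (n : nat) (P : 'I_n -> linord X) : rel X :=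
  fun x y => n < 2 * #|[set i | prefers (P i) x y]|.

Definition acyclic (X : finType) (e : rel X) : Prop :=
  forall c : seq X, c != [::] -> ~~ cycle e c.

Definition condorcet (X : finType) (D : {set linord X}) : Prop :=
  forall (n : nat) (P : 'I_n -> linord X),
    (forall i, P i \in D) -> acyclic (majority P).

(* Main.v *)
Require Import Defs.
From HB Require Import structures.
From mathcomp Require Import all_boot.
From mathcomp Require Import zify.

(** Compare two orders [S], [T] by their agreement with a base order [L]: [S] is
    closer to [L] than [T] when [L :&: T] is included in [S]. A domain totally
    preordered by this relation, for some [L], is single-crossing, so a maximal
    single-crossing domain contains every order comparable with all its members.
    Hence it contains the reverse of its first order, and consecutive orders of
    its chain differ by one adjacent transposition.

    A domain is Condorcet iff it has no cyclic triple xyz, yzx, zxy. If two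
    consecutive switching pairs are disjoint, performing them in the other order
    yields a new order which, on every triple, agrees with a member of the
    domain, so the domain is not a maximal Condorcet domain. Conversely, let [S]
    create no cyclic triple with the chain. When consecutive switching pairs
    meet, an [S] that performs the second switch performs the first one. So [S]
    performs exactly the first [k] switches for some [k]; since the chain ends
    at the reverse order, every pair is switched, and [S] is the [k]-th order. *)

Set Implicit Arguments.
Unset Strict Implicit.
Unset Printing Implicit Defensive.

Section LinearOrders.
Variable X : finType.
Implicit Types (L S T : linord X) (x y z : X) (D : {set linord X}).

(** * Strict linear orders as relations *)

Lemma prefers_irr L x : prefers L x x = false.
Proof. by case: L => g gP; have /and3P[/forallP/(_ x)/negbTE] := gP. Qed.

Lemma prefers_trans L : transitive (prefers L).
Proof.
case: L => g gP y x z; have /and3P[_ /forallP h _] := gP.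
by move: (h x) => /forallP/(_ y)/forallP/(_ z)/implyP h1 /h1/implyP.
Qed.

Lemma prefers_total L x y : x != y -> prefers L x y || prefers L y x.
Proof.
by case: L => g gP; have /and3P[_ _ /forallP/(_ x)/forallP/(_ y)/implyP] := gP; apply.
Qed.

Lemma prefersN L x y : x != y -> prefers L y x = ~~ prefers L x y.
Proof.
move=> xy; have := prefers_total L xy.
case Exy: (prefers L x y) => //=; case Eyx: (prefers L y x) => // _.
by have := prefers_trans Exy Eyx; rewrite prefers_irr.
Qed.

Lemma prefers_neq L x y : prefers L x y -> x != y.
Proof. by apply: contraTneq => ->; rewrite prefers_irr. Qed.

Lemma prefers_asym L x y : prefers L x y -> prefers L y x = false.
Proof. by move=> xy; rewrite (prefersN _ (prefers_neq xy)) xy. Qed.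

(** By totality, no strict linear order is properly contained in another. *)
Lemma linordP S T : (forall x y, prefers S x y -> prefers T x y) -> S = T.
Proof.
move=> ST; apply: val_inj; apply/setP=> -[x y]; apply/idP/idP; first exact: ST.
move=> Txy; have xy := prefers_neq Txy.
apply: contraTT (Txy) => /=.
by rewrite -/(prefers S x y) -(prefersN _ xy) => /ST/prefers_asym/negbT.
Qed.

Lemma linord_of_rel (r : rel X) :
    irreflexive r -> transitive r -> (forall x y, x != y -> r x y || r y x) ->
  exists L, prefers L =2 r.
Proof.
move=> irr tr tot.
have rP: strict_linear_order [set p | r p.1 p.2].
  apply/and3P; split.
  - by apply/forallP=> x; rewrite inE irr.
  - apply/forallP=> x; apply/forallP=> y; apply/forallP=> z; rewrite !inE /=.
    by apply/implyP=> xy; apply/implyP; apply: tr.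
  - apply/forallP=> x; apply/forallP=> y; apply/implyP=> /tot; by rewrite !inE.
by exists (Linord rP) => x y; rewrite /prefers inE.
Qed.

Definition agree_on (A : {set X}) S (r : rel X) :=
  forall x y, x \in A -> y \in A -> prefers S x y = r x y.

(** The axioms of a strict linear order involve at most three alternatives at a time. This
    recognises as an order a relation patched together from several orders. *)
Lemma linord_of_triples (r : rel X) :
    (forall x y z, exists S, agree_on [set x; y; z] S r) ->
  exists L, prefers L =2 r.
Proof.
move=> h; apply: linord_of_rel.
- move=> x; have [S hS] := h x x x.
  by rewrite -hS ?prefers_irr // !inE eqxx.
- move=> y x z; have [S hS] := h x y z.
  by rewrite -!hS ?inE ?eqxx ?orbT //; apply: prefers_trans.
- move=> x y xy; have [S hS] := h x y y.
  by rewrite -!hS ?inE ?eqxx ?orbT // prefers_total.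
Qed.

(** * Closeness to a base order (the weak Bruhat order) and single-crossing domains *)

Definition closer L : rel (linord X) :=
  fun S T => graph L :&: graph T \subset graph S.

Lemma closerP L S T :
  reflect (forall x y, prefers L x y -> prefers T x y -> prefers S x y)
          (closer L S T).
Proof.
apply: (iffP subsetP) => [h x y Lxy Txy | h [x y]].
  by apply: (h (x, y)); rewrite inE; apply/andP.
by rewrite inE => /andP[]; apply: h.
Qed.

Lemma closer_refl L : reflexive (closer L).
Proof. by move=> S; apply/closerP. Qed.

Lemma closer_trans L : transitive (closer L).
Proof.
by move=> T S U /closerP ST /closerP TU; apply/closerP=> x y Lxy /TU Txy; auto.
Qed.

(** Sorting [D] by closeness to [L] gives the enumeration: disagreements with [L] only accumulate
    along it, so each pair switches at most once. *)
Lemma closer_single_crossing L D :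
  {in D &, total (closer L)} -> single_crossing D.
Proof.
move=> tot; pose s := sort (closer L) (enum D).
have s_sorted : sorted (closer L) s.
  apply: (@sort_sorted_in _ (mem D)) => //.
  by apply/allP=> S; rewrite mem_enum.
have s_uniq : uniq s by rewrite sort_uniq enum_uniq.
have s_nth (j k : nat) : j <= k -> k < size s ->
    closer L (nth L s j) (nth L s k).
  move=> jk ks; apply: (sorted_leq_nth (@closer_trans L) (@closer_refl L)) => //.
  by rewrite inE (leq_ltn_trans jk).
exists (size s), (fun j => nth L s j); split.
- move=> j k /eqP; rewrite nth_uniq // => /eqP; exact: val_inj.
- apply/setP=> S; rewrite -[S \in D]mem_enum -(mem_sort (closer L)) -/s.
  apply/idP/imsetP => [|[j _ ->]]; last exact: mem_nth.
  by move=> /(nthP L)[j js <-]; exists (Ordinal js).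
have key x y : prefers L x y ->
    interval_of_indices [set j : 'I_(size s) | prefers (nth L s j) x y] /\
    interval_of_indices [set j : 'I_(size s) | prefers (nth L s j) y x].
  move=> Lxy; split=> i j k ij jk; rewrite !inE => hi hk.
    exact: (closerP _ _ _ (s_nth j k jk (ltn_ord k))).
  move: hi; rewrite !(prefersN _ (prefers_neq Lxy)); apply: contraNN.
  exact: (closerP _ _ _ (s_nth i j ij (ltn_ord j))).
move=> x y xy; have /orP[/key //|/key[]] := prefers_total L xy; by split.
Qed.

(** Adding [T] to [D] keeps closeness to [L] total, so the larger domain would still be
    single-crossing. *)
Lemma maximal_closer L D T : maximal_domain (@single_crossing X) D ->
    {in D &, total (closer L)} ->
    {in D, forall S, closer L S T || closer L T S} -> T \in D.
Proof.
move=> [_ maxD] tot hT; apply/negPn/negP => TD; apply: maxD.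
exists (T |: D); split; last first.
  rewrite properE subsetUr; apply/subsetPn; exists T => //; exact: setU11.
apply: (@closer_single_crossing L) => S U.
move=> /setU1P[->|SD] /setU1P[->|UD]; rewrite ?closer_refl //.
- by rewrite orbC hT.
- exact: hT.
- exact: tot.
Qed.

(** * Reversal, switching pairs and adjacent transpositions *)

Lemma exists_reverse L : exists T, forall x y, prefers T x y = prefers L y x.
Proof.
apply: (@linord_of_rel (fun x y => prefers L y x)).
- by move=> x; rewrite prefers_irr.
- by move=> y x z xy yz; apply: prefers_trans yz xy.
- by move=> x y xy; rewrite orbC prefers_total.
Qed.

Lemma switching_pairP S T A : switching_pair S T A ->
  exists a b, [/\ A = [set a; b], prefers S a b, prefers T b a
    & forall x y, x != y -> [set x; y] != A -> prefers S x y = prefers T x y].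
Proof.
case=> /eqP/cards2P[a [b [ab eA]]] hA.
have hST x y : x != y -> [set x; y] != A -> prefers S x y = prefers T x y.
  by move=> xy /eqP nA; apply/eqP/negPn/negP => /eqP d; apply/nA/(hA _ _ xy).
have dab := (hA _ _ ab).2 (esym eA).
case Sab: (prefers S a b); [exists a, b | exists b, a]; split=> //.
- by rewrite (prefersN _ ab); move: dab; rewrite Sab; case: prefers.
- by rewrite setUC.
- by rewrite (prefersN _ ab) Sab.
- by move: dab; rewrite Sab; case: prefers.
Qed.

(* A pair inverted between [S] and [T] with fewest elements of [S] in between is
   adjacent in [S]. *)
Lemma exists_adjacent_inversion S T : S != T ->
  exists x y, [/\ prefers S x y, prefers T y x
    & forall z, ~~ (prefers S x z && prefers S z y)].
Proof.
move=> ST.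
pose btw (p : X * X) := #|[set z | prefers S p.1 z && prefers S z p.2]|.
pose P (p : X * X) := prefers S p.1 p.2 && prefers T p.2 p.1.
have [p0 Pp0] : exists p, P p.
  apply/existsP; apply: contra_neqT ST => /existsPn noP; apply: linordP => x y Sxy.
  have := noP (x, y); rewrite /P /= Sxy /= (prefersN _ (prefers_neq Sxy)).
  by rewrite negbK.
case: (arg_minnP btw Pp0) => -[x y] /andP[/= Sxy Tyx] hmin.
exists x, y; split=> // z; apply/negP => /andP[Sxz Szy].
(* Since [T] ranks [y] above [x], it inverts [(x, z)] or [(z, y)], and either pair has fewer
   elements of [S] strictly in between. *)
have [Tzx | Txz] := boolP (prefers T z x).
  have := hmin (x, z); rewrite /P /= Sxz Tzx => /(_ isT); rewrite leqNgt => /negP; apply.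
  apply: proper_card; apply/properP; split.
    apply/subsetP=> w; rewrite !inE /= => /andP[-> Swz] /=.
    exact: prefers_trans Swz Szy.
  by exists z; rewrite !inE /= ?prefers_irr ?andbF // Sxz.
have Tyz : prefers T y z.
  move: Txz; rewrite -(prefersN _ _) 1?eq_sym ?(prefers_neq Sxz) //.
  exact: prefers_trans.
have := hmin (z, y); rewrite /P /= Szy Tyz => /(_ isT); rewrite leqNgt => /negP; apply.
apply: proper_card; apply/properP; split.
  apply/subsetP=> w; rewrite !inE /= => /andP[Szw ->]; rewrite andbT.
  exact: prefers_trans Sxz Szw.
by exists z; rewrite !inE /= ?prefers_irr // Sxz.
Qed.

(** By adjacency every other alternative lies above both [x] and [y] or below both, so exchanging
    these two preserves transitivity. *)
Lemma exists_swap S x y : prefers S x y ->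
    (forall z, ~~ (prefers S x z && prefers S z y)) ->
  exists U, forall u v, prefers U u v =
    ((u, v) == (y, x)) || ((u, v) != (x, y)) && prefers S u v.
Proof.
move=> Sxy adj.
have xy := prefers_neq Sxy.
have up z : prefers S x z -> z != y -> prefers S y z.
  by move=> Sxz zy; rewrite (prefersN _ zy); move: (adj z); rewrite Sxz.
have dn z : prefers S z y -> z != x -> prefers S z x.
  rewrite eq_sym => Szy xz; rewrite (prefersN _ xz).
  by move: (adj z); rewrite Szy andbT.
apply: linord_of_rel.
- move=> u; rewrite prefers_irr andbF orbF xpair_eqE.
  by apply/negbTE; apply: contraNN xy => /andP[/eqP e1 /eqP e2]; rewrite -e1 -e2.
- move=> v u w; rewrite !xpair_eqE.
  move=> /orP[/andP[/eqP-> /eqP->]|/andP[nuv Suv]]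
         /orP[/andP[/eqP ev /eqP->]|/andP[nvw Svw]].
  + by rewrite -ev eqxx in xy.
  + move: nvw; rewrite eqxx /= => wy.
    by rewrite (up _ Svw wy) eqxx [y == x]eq_sym (negbTE xy) /= orbT.
  + rewrite ev eqxx andbT in nuv Suv *.
    by rewrite (dn _ Suv nuv) [x == y](negbTE xy) andbF orbT.
  + rewrite (prefers_trans Suv Svw) andbT.
    have [/andP[/eqP eu /eqP ew]|_] := boolP ((u == x) && (w == y)); last by rewrite orbT.
    by move: (adj v); rewrite -eu -ew Suv Svw.
- move=> u v uv; rewrite !xpair_eqE.
  have [//|nyx] := boolP ((u == y) && (v == x)).
  have [xy'|nxy] := boolP ((u == x) && (v == y)).
    by rewrite [(v == y) && _]andbC xy' orbT.
  by rewrite [(v == x) && _]andbC (negbTE nyx) [(v == y) && _]andbC (negbTE nxy) prefers_total.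
Qed.

(** * Cyclic triples and majority cycles *)

Definition cyclic_triple R1 R2 R3 x y z :=
  [&& prefers R1 x y, prefers R1 y z, prefers R2 y z, prefers R2 z x,
      prefers R3 z x & prefers R3 x y].

Definition cyclic_free D := forall R1 R2 R3 x y z,
  R1 \in D -> R2 \in D -> R3 \in D -> ~~ cyclic_triple R1 R2 R3 x y z.

(** Take one voter for each order: every edge of the cycle is shared by two of the three voters. *)
Lemma condorcet_cyclic_free D : condorcet D -> cyclic_free D.
Proof.
move=> cD R1 R2 R3 x y z D1 D2 D3; apply/negP => /and5P[h1 h2 h3 h4 /andP[h5 h6]].
pose P := tnth [tuple R1; R2; R3].
have PD i : P i \in D.
  by rewrite /P (tnth_nth R1); case: i => -[|[|[|]]].
have maj (i j : 'I_3) u v : i != j -> prefers (P i) u v -> prefers (P j) u v ->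
    majority P u v.
  move=> ij Pi Pj; rewrite /majority.
  have : #|[set i; j]| <= #|[set i | prefers (P i) u v]|.
    by apply/subset_leq_card/subsetP=> k /set2P[]->; rewrite inE.
  by rewrite cards2 ij /=; lia.
have /negP := cD 3 P PD [:: x; y; z] isT; apply => /=.
rewrite (maj (@Ordinal 3 0 isT) (@Ordinal 3 2 isT)) //.
rewrite (maj (@Ordinal 3 0 isT) (@Ordinal 3 1 isT)) //.
by rewrite (maj (@Ordinal 3 1 isT) (@Ordinal 3 2 isT)).
Qed.

Lemma majority_common n (P : 'I_n -> linord X) x y u v :
  majority P x y -> majority P u v -> exists i, prefers (P i) x y && prefers (P i) u v.
Proof.
rewrite /majority; set A := [set i | _]; set B := [set i | _] => hA hB.
suff /set0Pn[i] : A :&: B != set0 by rewrite !inE; exists i.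
rewrite -card_gt0; have := cardsUI A B; have := subset_leq_card (subsetT (A :|: B)).
rewrite cardsT card_ord; lia.
Qed.

Lemma majority_irr n (P : 'I_n -> linord X) x : majority P x x = false.
Proof.
rewrite /majority; apply/negbTE; rewrite -leqNgt.
by rewrite (_ : [set _ | _] = set0) ?cards0 //; apply/setP=> i; rewrite !inE prefers_irr.
Qed.

Lemma majority_total n (P : 'I_n -> linord X) x y :
  odd n -> x != y -> majority P x y || majority P y x.
Proof.
rewrite /majority; set A := [set i | _]; set B := [set i | _] => hn xy.
have -> : B = ~: A by apply/setP=> i; rewrite !inE (prefersN _ xy).
have := cardsC A; rewrite card_ord; lia.
Qed.

(** For an odd electorate, majority is total on distinct alternatives, so failing transitivity there
    gives a majority 3-cycle. Any two majorities share a voter, and the voters common to two edges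
    of the cycle form a cyclic triple. *)
Lemma cyclic_free_odd n (P : 'I_n -> linord X) D : cyclic_free D -> odd n ->
  (forall i, P i \in D) -> acyclic (majority P).
Proof.
move=> cD hn PD [|x s] // _; apply/negP => /=.
have tr : transitive (majority P).
  move=> b a c ab bc; apply/negPn/negP => nac.
  have ac : a != c.
    apply/eqP => ac; rewrite -ac in bc.
    have [i /andP[h1 h2]] := majority_common ab bc.
    by rewrite (prefers_asym h1) in h2.
  have ca : majority P c a by have := majority_total P hn ac; rewrite (negbTE nac).
  have [i /andP[i1 i2]] := majority_common ab bc.
  have [j /andP[j1 j2]] := majority_common bc ca.
  have [k /andP[k1 k2]] := majority_common ca ab.
  have /negP := cD _ _ _ a b c (PD i) (PD j) (PD k); apply.
  by rewrite /cyclic_triple i1 i2 j1 j2 k1 k2.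
move=> /(order_path_min tr)/allP/(_ x).
by rewrite mem_rcons mem_head majority_irr => /(_ isT).
Qed.

Lemma cyclic_free_condorcet D : cyclic_free D -> condorcet D.
Proof.
move=> cD n P PD.
have [hn|] := boolP (odd n); first exact: cyclic_free_odd PD.
case: n P PD => [|n] P PD hn c c0.
  case: c c0 => // x s _; apply/negP => /= /pathP - /(_ x 0).
  rewrite size_rcons => /(_ isT); rewrite /majority -[X in X < _]/0.
  by rewrite (_ : #|_| = 0) //; apply/eqP; rewrite cards_eq0; apply/eqP/setP=> -[].
(* An even electorate is made odd by counting one voter twice; a strict majority of it has margin at
   least two, hence survives the extra vote. *)
pose Q (i : 'I_n.+2) := if unlift ord0 i is Some j then P j else P ord0.
have QD i : Q i \in D by rewrite /Q; case: unlift.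
have hQ : odd n.+2 by move: hn => /=; rewrite negbK.
apply: contraNN (cyclic_free_odd cD hQ QD c0).
apply: (@sub_cycle _ (majority P) (majority Q)) => x y.
rewrite /majority => hP.
have : #|[set i | prefers (P i) x y]| <= #|[set i | prefers (Q i) x y]|.
  rewrite -(card_imset _ (@lift_inj _ ord0)).
  apply/subset_leq_card/subsetP=> _ /imsetP[i hi ->].
  by move: hi; rewrite !inE /Q liftK.
move: hP hn; rewrite /=; lia.
Qed.

(** * Two consecutive switches, disjoint or sharing an alternative *)

Lemma set2_eq a b x y : a != b -> [set a; b] = [set x; y] ->
  (a = x /\ b = y) \/ (a = y /\ b = x).
Proof.
move=> ab e.
have : a \in [set x; y] by rewrite -e set21.
have : b \in [set x; y] by rewrite -e set22.
move=> /set2P[]eb /set2P[]ea; [|by right|by left|];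
  by rewrite ea eb eqxx in ab.
Qed.

(** [T] is the intermediate order when the switch of [B] is performed before that of [A]. *)
Lemma exists_independent_switch S1 S2 S3 A B :
    switching_pair S1 S2 A -> switching_pair S2 S3 B -> A :&: B = set0 ->
  exists T,
    (forall u v, prefers T u v =
       if [set u; v] == A then prefers S1 u v else prefers S3 u v) /\
    forall x y z, agree_on [set x; y; z] S1 (prefers T) \/
                  agree_on [set x; y; z] S3 (prefers T).
Proof.
move=> sA sB AB0.
have [cA _] := sA; have [cB _] := sB.
have [a [b [_ _ _ eqA]]] := switching_pairP sA.
have [c [d [_ _ _ eqB]]] := switching_pairP sB.
pose r u v := if [set u; v] == A then prefers S1 u v else prefers S3 u v.
have r_triple x y z :
    agree_on [set x; y; z] S1 r \/ agree_on [set x; y; z] S3 r.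
  (* A triple containing [A] has no room for the disjoint pair [B], so inside it [S1] and [S3]
     differ on [A] only. *)
  have [At|nAt] := boolP (A \subset [set x; y; z]); [left|right] => u v ut vt.
    rewrite /r; have [//|nA] := eqVneq [set u; v] A.
    have [->|uv] := eqVneq u v; first by rewrite !prefers_irr.
    rewrite (eqA _ _ uv nA) eqB //; apply/eqP => eB.
    have Bt : B \subset [set x; y; z] by rewrite -eB; apply/subsetP=> w /set2P[]->.
    have := subset_leq_card (_ : A :|: B \subset [set x; y; z]).
    rewrite subUset At Bt => /(_ isT); apply/negP; rewrite -ltnNge.
    have := cardsUI A B; rewrite AB0 cards0 cA cB addn0 => ->.
    rewrite setUC; apply: leq_ltn_trans (leq_card_setU _ _) _.
    by rewrite cards1 cards2; case: eqP.
  rewrite /r; case: eqP => // eA; case/negP: nAt.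
  by rewrite -eA; apply/subsetP=> w /set2P[]->.
have [|T TE] := @linord_of_triples r.
  move=> x y z; by case: (r_triple x y z) => h; [exists S1|exists S3].
exists T; split=> [u v|x y z]; first by rewrite TE.
by case: (r_triple x y z) => h; [left|right] => u v ut vt; rewrite TE h.
Qed.

(** A cyclic triple sees only three alternatives, on which [T] can be replaced by a member of
    [D]. *)
Lemma cyclic_freeU1 D T :
    (forall x y z, exists2 S, S \in D & agree_on [set x; y; z] S (prefers T)) ->
  cyclic_free D -> cyclic_free (T |: D).
Proof.
move=> hT cD R1 R2 R3 x y z D1 D2 D3.
have repl U : U \in T |: D ->
    exists2 S, S \in D & agree_on [set x; y; z] S (prefers U).
  by move=> /setU1P[->|UD]; [exact: hT | exists U].
have [S1 /cD c1 e1] := repl _ D1; have [S2 /c1 c2 e2] := repl _ D2.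
have [S3 /c2 c3 e3] := repl _ D3.
have := c3 x y z.
by rewrite /cyclic_triple e1 ?e1 ?e2 ?e2 ?e3 ?e3 // !inE eqxx ?orbT.
Qed.

Lemma concatenated_switch D S1 S2 S3 S a b u v :
    cyclic_free D -> S1 \in D -> S3 \in D -> S \in D ->
    switching_pair S1 S2 [set a; b] -> switching_pair S2 S3 [set u; v] ->
    [set a; b] :&: [set u; v] != set0 ->
    prefers S1 a b -> prefers S2 b a -> prefers S3 b a ->
    prefers S2 u v -> prefers S3 v u ->
  prefers S v u -> prefers S b a.
Proof.
move=> cD D1 D3 DS sA sB meet S1ab S2ba S3ba S2uv S3vu Svu.
have ab := prefers_neq S1ab; have uv := prefers_neq S2uv.
have off x y c d : x != c -> x != d -> [set x; y] != [set c; d].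
  move=> xc xd; apply/eqP => e; have := set21 x y.
  by rewrite e !inE (negbTE xc) (negbTE xd).
have stay T1 T2 c d x y : switching_pair T1 T2 [set c; d] -> x != c -> x != d ->
    prefers T1 x y = prefers T2 x y /\ prefers T1 y x = prefers T2 y x.
  have [->|xy] := eqVneq x y; first by rewrite !prefers_irr.
  move=> /switching_pairP[_ [_ [_ _ _ h]]] xc xd.
  split; first by apply: h => //; apply: off.
  by apply: h; [rewrite eq_sym | rewrite setUC off].
rewrite (prefersN _ ab); apply/negP => Sab.
(* If [a = u] or [b = v], then [S1], [S3] and [S] form a cyclic triple. If [a = v] or [b = u], the
   two unshared alternatives keep their ranking from [S1] to [S3], against transitivity. *)
case/set0Pn: meet => w /setIP[/set2P[] -> /set2P[] e]; subst.
- have vb : v != b by apply: contraTneq S2uv => ->; rewrite (prefers_asym S2ba).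
  have va : v != u by rewrite eq_sym.
  have bu : b != u by rewrite eq_sym.
  have bv : b != v by rewrite eq_sym.
  have [e1 e2] := stay _ _ _ _ _ u sA va vb; have [e3 e4] := stay _ _ _ _ _ b sA va vb.
  have [e5 e6] := stay _ _ _ _ _ v sB bu bv.
  have S2bv := prefers_trans S2ba S2uv.
  have /negP := cD _ _ _ u b v D1 D3 DS; apply.
  by rewrite /cyclic_triple S1ab e4 S2bv -e5 S2bv S3vu Svu Sab.
- have ub : u != b by apply: contraTneq S3vu => ->; rewrite (prefers_asym S3ba).
  have bu : b != u by rewrite eq_sym.
  have bv : b != v by rewrite eq_sym.
  have [e1 e2] := stay _ _ _ _ _ v sA uv ub; have [e3 e4] := stay _ _ _ _ _ b sA uv ub.
  have [e5 e6] := stay _ _ _ _ _ u sB bu bv.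
  have S1uv : prefers S1 u v by rewrite e1.
  have := prefers_asym (prefers_trans S3ba S3vu).
  by rewrite -e6 -e3 (prefers_trans S1uv S1ab).
- have va : v != a by apply: contraTneq S3vu => ->; rewrite (prefers_asym S3ba).
  have vu : v != u by rewrite eq_sym.
  have av : a != v by rewrite eq_sym.
  have [e1 e2] := stay _ _ _ _ _ u sA va vu; have [e3 e4] := stay _ _ _ _ _ a sA va vu.
  have [e5 e6] := stay _ _ _ _ _ v sB ab av.
  have := prefers_trans S3vu S3ba; rewrite -e6 -e3 => S1va.
  by have := prefers_trans S1va S1ab; rewrite e1 (prefers_asym S2uv).
- have ua : u != a by apply: contraTneq S2uv => ->; rewrite (prefers_asym S2ba).
  have au : a != u by rewrite eq_sym.
  have [e1 e2] := stay _ _ _ _ _ v sA ua uv; have [e3 e4] := stay _ _ _ _ _ a sA ua uv.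
  have [e5 e6] := stay _ _ _ _ _ u sB au ab.
  have S2ua := prefers_trans S2uv S2ba.
  have /negP := cD _ _ _ a v u DS D3 D1; apply.
  by rewrite /cyclic_triple Sab Svu S3vu -e6 S2ua e3 S2ua S1ab.
Qed.

(** * The chain of a single-crossing domain *)

Section Enumeration.
Variables (D : {set linord X}) (m : nat) (R : 'I_m -> linord X).
Hypothesis hR : single_crossing_enum D R.

Lemma enum_mem i : R i \in D.
Proof. by case: hR => _ -> _; apply/imsetP; exists i. Qed.

Lemma enum_between (i j k : 'I_m) x y : i <= j -> j <= k ->
  prefers (R i) x y = prefers (R k) x y -> prefers (R j) x y = prefers (R i) x y.
Proof.
move=> ij jk; have [->|xy] := eqVneq x y; first by rewrite !prefers_irr.
have [_ _ /(_ _ _ xy)[h1 h2]] := hR.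
case Ri: (prefers (R i) x y) => Rk.
  by have := h1 i j k ij jk; rewrite !inE -Rk Ri => ->.
have := h2 i j k ij jk; rewrite !inE !(prefersN _ xy) -Rk Ri.
by move=> /(_ isT isT)/negbTE.
Qed.

Lemma enum_closer (i j k : 'I_m) : i <= j -> j <= k -> closer (R i) (R j) (R k).
Proof.
move=> ij jk; apply/closerP => x y Rixy Rkxy.
by rewrite (enum_between ij jk) // Rixy Rkxy.
Qed.

Lemma enum_closer_total (i0 : 'I_m) : i0 = 0 :> nat ->
  {in D &, total (closer (R i0))}.
Proof.
move=> i00; case: hR => _ -> _ _ _ /imsetP[j _ ->] /imsetP[k _ ->].
by case/orP: (leq_total j k) => /(enum_closer _) ->; rewrite ?orbT ?i00.
Qed.

(** One of the three indices lies between the other two. The preference shared by the outer orders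
    then passes to the middle one, which ranks that pair the other way. *)
Lemma enum_cyclic_free : cyclic_free D.
Proof.
have mid (i j k : 'I_m) x y z : (i <= j <= k) || (k <= j <= i) ->
    prefers (R i) x y -> prefers (R k) x y ->
    prefers (R j) y z -> prefers (R j) z x -> False.
  move=> ijk i_xy k_xy j_yz j_zx.
  suff: prefers (R j) x y by rewrite (prefers_asym (prefers_trans j_yz j_zx)).
  case/orP: ijk => /andP[h1 h2].
    by rewrite (enum_between h1 h2) i_xy ?k_xy.
  by rewrite (enum_between h1 h2) k_xy ?i_xy.
move=> R1 R2 R3 x y z; case: (hR) => _ -> _.
move=> /imsetP[i _ ->] /imsetP[j _ ->] /imsetP[k _ ->].
apply/negP => /and5P[i_xy i_yz j_yz j_zx /andP[k_zx k_xy]].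
have [h|n1] := boolP ((i <= j <= k) || (k <= j <= i)); first exact: (mid i j k x y z).
have [h|n2] := boolP ((i <= k <= j) || (j <= k <= i)); first exact: (mid i k j y z x).
have [h|n3] := boolP ((j <= i <= k) || (k <= i <= j)); first exact: (mid j i k z x y).
lia.
Qed.

Hypothesis hD : maximal_domain (@single_crossing X) D.

(** The reverse of the first order has no pair in common with it, so every order is closer. *)
Lemma maximal_enum_reverse (i0 : 'I_m) : i0 = 0 :> nat ->
  exists k, forall x y, prefers (R k) x y = prefers (R i0) y x.
Proof.
move=> i00; have [T hT] := exists_reverse (R i0).
suff: T \in D by case: hR => _ -> _ /imsetP[k _ eT]; exists k; rewrite -eT.
apply: maximal_closer hD (enum_closer_total i00) _ => S _.
by apply/orP; left; apply/closerP => x y L_xy; rewrite hT prefers_asym.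
Qed.

Lemma maximal_enum_switch (i j : 'I_m) : j = i.+1 :> nat ->
  exists A, switching_pair (R i) (R j) A.
Proof.
move=> ij; have [inj eD _] := hR.
have m0 : 0 < m by case: (i) => k; case: (m).
have Rij : R i != R j by apply/eqP => /inj eij; move: ij; rewrite eij; lia.
have [x [y [Ri_xy Rj_yx adj]]] := exists_adjacent_inversion Rij.
have xy := prefers_neq Ri_xy.
have [U hU] := exists_swap Ri_xy adj.
have [Uxy Uyx] : prefers U x y = false /\ prefers U y x.
  by rewrite !hU !eqxx !xpair_eqE [y == x]eq_sym (negbTE xy).
(* [U] performs a single inversion found in [R j], so it is farther than the orders up to [R i] and
   closer than those from [R j] on. *)
have : U \in D.
  apply: maximal_closer hD (@enum_closer_total (Ordinal m0) erefl) _ => S.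
  rewrite eD => /imsetP[l _ ->]; apply/orP.
  have [li|il] := leqP l i; [left|right]; apply/closerP => u v.
    rewrite hU => L_uv /orP[/eqP[eu ev]|/andP[_ Ri_uv]].
      have := @enum_closer (Ordinal m0) i j isT; rewrite ij leqnSn => /(_ isT)/closerP.
      by move=> /(_ u v L_uv); rewrite eu ev (prefers_asym Ri_xy) => /(_ Rj_yx).
    exact: (closerP _ _ _ (@enum_closer (Ordinal m0) l i isT li)).
  move=> L_uv Rl_uv.
  have Ri_uv := closerP _ _ _ (@enum_closer (Ordinal m0) i l isT (ltnW il)) _ _ L_uv Rl_uv.
  rewrite hU Ri_uv andbT; apply/orP; right; apply/eqP => -[eu ev].
  have := @enum_closer i j l; rewrite ij leqnSn il => /(_ isT isT)/closerP.
  by move=> /(_ u v Ri_uv Rl_uv); rewrite eu ev (prefers_asym Rj_yx).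
rewrite eD => /imsetP[l _ eU].
(* Hence [j <= l], and [R j] lies between [R i] and [U], which differ only on [x] and [y]. *)
have il : i < l.
  rewrite ltnNge; apply/negP => li; have := @enum_between l i j y x li.
  by rewrite ij leqnSn -eU Uyx Rj_yx (prefers_asym Ri_xy) => /(_ isT erefl).
exists [set x; y]; split=> [|u v uv]; first by rewrite cards2 xy.
split=> [dij|/(set2_eq uv)[][-> ->]]; last 2 first.
- by rewrite Ri_xy (prefers_asym Rj_yx).
- by rewrite Rj_yx (prefers_asym Ri_xy).
apply/eqP/negPn/negP => nuv; apply: dij; apply/esym.
apply: (@enum_between i j l); rewrite ?ij // -eU hU.
have -> : ((u, v) == (y, x)) = false.
  by apply: contraNF nuv => /eqP[-> ->]; rewrite setUC.
suff -> : (u, v) != (x, y) by [].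
by apply: contraNneq nuv => -[-> ->].
Qed.

Lemma maximal_condorcet_concatenation :
  maximal_domain (@condorcet X) D -> pairwise_concatenation R.
Proof.
move=> [/condorcet_cyclic_free cD maxD] i j k ij jk.
have [A sA] := maximal_enum_switch ij; have [B sB] := maximal_enum_switch jk.
exists A, B; split=> //; apply/eqP => AB0; apply: maxD.
have [T [hT triT]] := exists_independent_switch sA sB AB0.
exists (T |: D); split.
  apply/cyclic_free_condorcet/cyclic_freeU1 => // x y z.
  by case: (triT x y z) => h; [exists (R i)|exists (R k)]; rewrite ?enum_mem.
rewrite properE subsetUr; apply/subsetPn; exists T; first exact: setU11.
case: hR => _ -> _; apply/imsetP => -[l _ eT].
have [a [b [eA Ri_ab Rj_ba _]]] := switching_pairP sA.
have [c [d [eB Rj_cd Rk_dc stay]]] := switching_pairP sB.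
(* [T] has switched [B] but not [A]. If [l <= i], the pair [B] would switch back before [R j]; if
   [l > i], the pair [A] would switch back after [R j]. *)
have [li|jl] := leqP l i.
  have ndc : [set d; c] != A.
    apply/eqP => edc; move/setP: AB0 => /(_ c).
    by rewrite -edc eB !inE eqxx orbT.
  have := @enum_between l j k d c; rewrite -eT hT (negbTE ndc) (prefers_asym Rj_cd) Rk_dc.
  by move=> h; suff: false = true by []; apply: h; lia.
have := @enum_between i j l b a; rewrite -eT hT setUC -eA eqxx Rj_ba (prefers_asym Ri_ab).
by move=> h; suff: true = false by []; apply: h; lia.
Qed.

End Enumeration.

(** * From pairwise concatenation to Condorcet maximality *)

Lemma concatenation_maximal_condorcet D m (R : 'I_m -> linord X) :
    maximal_domain (@single_crossing X) D -> single_crossing_enum D R ->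
  pairwise_concatenation R -> maximal_domain (@condorcet X) D.
Proof.
move=> hD hR hcat; split; first exact/cyclic_free_condorcet/enum_cyclic_free/hR.
move=> [D' [/condorcet_cyclic_free cD' /properP[DD' [S SD' /negP SD]]]]; apply: SD.
case: m R hR hcat => [|n] R hR hcat.
  have noD T : T \in D -> False by case: hR => _ -> _ /imsetP[[]].
  by apply: (maximal_closer (L := S) hD) => T => [U /noD|/noD].
(* Natural indices ease induction; [inord] sends those beyond [n] to [ord0], hence the bounds
   below. *)
pose r t := R (inord t).
have rE t : t <= n -> (inord t : 'I_n.+1) = t :> nat by move=> ?; rewrite inordK.
have rD t : r t \in D' by apply: (subsetP DD'); exact: enum_mem hR _.
have [last hlast] := maximal_enum_reverse hR hD (erefl : @ord0 n = 0 :> nat).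
(* [up t] means that [S] performs the switch from [r t] to [r t.+1]; concatenation makes the set of
   such [t] downward closed. *)
pose up t := exists x y, [/\ prefers (r t) x y, prefers (r t.+1) y x & prefers S y x].
have up_pred t : t.+2 <= n -> up t.+1 -> up t.
  move=> tn [u [v [h1 h2 h3]]].
  have [||A [B [sA sB AB]]] := hcat (inord t) (inord t.+1) (inord t.+2).
  - by rewrite !rE //; lia.
  - by rewrite !rE //; lia.
  have [a [b [eA rab rba _]]] := switching_pairP sA.
  have uv := prefers_neq h1.
  have eB : [set u; v] = B.
    by apply/(sB.2 _ _ uv); rewrite -/(r t.+1) -/(r t.+2) h1 (prefers_asym h2).
  exists a, b; split=> //.
  apply: (concatenated_switch cD' (rD t) (rD t.+2) SD' (a:=a) (b:=b) _ _ _ rab rba _ h1 h2 h3).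
  - by rewrite -eA.
  - by rewrite eB.
  - by rewrite -eA eB.
  - apply/negPn/negP; rewrite (prefersN _ (prefers_neq rab)) negbK => r2ab.
    have := @enum_between _ _ _ hR (inord t) (inord t.+1) (inord t.+2) a b.
    by rewrite rab r2ab (prefers_asym rba) !rE => [h||| ]; try lia; suff: false = true by []; apply: h; lia.
have up_le k t : k <= t -> t < n -> up t -> up k.
  elim: t => [|t IH]; first by rewrite leqn0 => /eqP->.
  rewrite leq_eqVlt => /orP[/eqP-> //|kt] tn /(up_pred _ tn); apply: IH => //; lia.
have between s t u x y : s <= t -> t <= u -> u <= n ->
    prefers (r s) x y = prefers (r u) x y -> prefers (r t) x y = prefers (r s) x y.
  by move=> st tu un; apply: (enum_between hR); rewrite !rE //; lia.
have r0 : r 0 = R ord0 by congr R; apply: val_inj; rewrite /= rE.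
have r_last x y : prefers (r 0) x y -> prefers (r n) y x.
  move=> r0xy; rewrite (prefersN _ (prefers_neq r0xy)); apply/negP => rnxy.
  have := @between 0 last n x y (leq0n _) (leq_ord _) (leqnn n).
  rewrite r0xy rnxy /r inord_val hlast -r0 (prefers_asym r0xy).
  by move=> /(_ erefl).
pose close t := (t <= n) && closer (r 0) (r t) S.
(* [k] is the largest index such that [S] performs all of the first [k] switches. *)
have [||k /andP[kn /closerP closek] kmax] := @ex_maxnP close n.
- by exists 0; apply/andP; split=> //; apply/closerP.
- by move=> t /andP[].
suff -> : S = r k by apply: enum_mem hR _.
apply/esym/linordP => x y rk_xy; have xy := prefers_neq rk_xy.
apply/negPn; rewrite -(prefersN _ xy); apply/negP => S_yx.
have r0_xy : prefers (r 0) x y.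
  rewrite -[prefers _ _ _]negbK -(prefersN _ xy); apply/negP => r0_yx.
  by have := closek _ _ r0_yx S_yx; rewrite (prefers_asym rk_xy).
pose switched t := (k <= t) && prefers (r t) y x.
(* The chain ends at the reverse order, so the pair on which [S] departs from [r k] is switched
   later. [S] performs that switch, hence also the one at [k]. *)
have [|t /andP[kt rt_yx] tmin] := @ex_minnP switched.
  by exists n; rewrite /switched kn r_last.
have tn : t <= n by apply: tmin; rewrite /switched kn r_last.
case: t kt rt_yx tmin tn => [|t] kt rt_yx tmin tn.
  by move: kt rk_xy; rewrite leqn0 => /eqP->; rewrite (prefers_asym rt_yx).
have kt' : k <= t.
  move: kt; rewrite leq_eqVlt => /orP[/eqP ek|//].
  by move: rk_xy; rewrite ek (prefers_asym rt_yx).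
have rt_xy : prefers (r t) x y.
  rewrite -[prefers _ _ _]negbK -(prefersN _ xy); apply/negP => h.
  by have := tmin t; rewrite /switched kt' h ltnn => /(_ isT).
have [u [v [rk_uv rk1_vu S_vu]]] : up k by apply: (up_le k t) => //; exists x, y.
have kn' : k < n by lia.
have : ~~ close k.+1 by apply/negP => /kmax; rewrite ltnn.
(* By maximality of [k], [S] fails to invert a pair [(a, b)] inverted in [r k.+1] but not in [r k].
   This is the switching pair at [k], which [S] does invert. *)
rewrite /close kn' => /subsetPn[[a b]]; rewrite inE => /andP[r0_ab S_ab] nrk1.
have rk_ab : prefers (r k) a b by apply: closek.
have [|A [_ sA]] := maximal_enum_switch hR hD (i := inord k) (j := inord k.+1).
  by rewrite !rE.
have uv := prefers_neq rk_uv.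
have eA := (sA _ _ (prefers_neq rk_ab)).1.
have : [set u; v] = A.
  by apply/(sA _ _ uv); rewrite -/(r k) -/(r k.+1) rk_uv (prefers_asym rk1_vu).
rewrite -eA => [|]; last first.
  by rewrite -/(r k) -/(r k.+1) rk_ab => e; move: nrk1; rewrite -/(prefers _ _ _) -e.
case/(set2_eq uv) => -[eu ev]; subst u v.
  by rewrite (prefers_asym S_ab) in S_vu.
by rewrite (prefers_asym rk_ab) in rk_uv.
Qed.
End LinearOrders.

Unset Implicit Arguments.

Theorem theorem9 (X : finType) (D : {set linord X})
    (m : nat) (R : 'I_m -> linord X)
    (hD : maximal_domain (@single_crossing X) D)
    (hR : single_crossing_enum D R) :
  maximal_domain (@condorcet X) D <-> pairwise_concatenation R.
Proof.
split; first exact: maximal_condorcet_concatenation.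
exact: concatenation_maximal_condorcet.
Qed.
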